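(* Let $m \ge 4$ be an integer and let $\phi=(\Phi_1,\Phi_2,\dots,\Phi_m)$ be an $m$-clique hole (as defined in the context). Then $\phi$ is $m$-colorable if and only if $$\sum_{i=1}^{m} |\Phi_i \cap \Phi_{i+1}| \le m\left\lfloor \frac{m}{2}\right\rfloor ,$$ where indices are taken cyclically modulo $m$ (so $\Phi_{m+1}=\Phi_1$).
   Context: Indices are taken cyclically modulo $m$ throughout. An $m$-clique hole is a sequence $\phi=(\Phi_1,\dots,\Phi_m)$ of $m$ distinct nonempty finite vertex sets (cliques) such that $|\Phi_i|\le m$ for all $i$, and for all $i\neq j$ one has $\Phi_i\cap\Phi_j\neq\emptyset$ if and only if $j\equiv i+1$ or $j\equiv i-1 \pmod m$; equivalently, the intersection graph of the $\Phi_i$ is a chordless cycle on $m$ vertices. The graph of $\phi$ has vertex set $\Phi_1\cup\dots\cup\Phi_m$, two distinct vertices being adjacent if and only if they lie in a common $\Phi_i$ (so each $\Phi_i$ is a clique). $\phi$ is called $m$-colorable if the vertices of this graph can be colored with $m$ colors so that no two adjacent vertices receive the same color. *)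

(* Defs.v *)
From mathcomp Require Import all_boot.

Set Implicit Arguments.
Unset Strict Implicit.
Unset Printing Implicit Defensive.

(* Indices live in 'I_m, so index i here is the usual index i + 1; [ordS] and  *)
(* [ord_pred] are the cyclic successor and predecessor modulo m.              *)
Record clique_hole (V : finType) (m : nat) (Phi : 'I_m -> {set V}) : Prop :=
  CliqueHole {
    ch_distinct : injective Phi;
    ch_nonempty : forall i, Phi i != set0;
    ch_card : forall i, #|Phi i| <= m;
    ch_cycle : forall i j, i != j ->
      (Phi i :&: Phi j != set0) = (j == ordS i) || (j == ord_pred i) }.

Definition ch_vertices (V : finType) (m : nat) (Phi : 'I_m -> {set V}) :
  {set V} := \bigcup_(i < m) Phi i.

Definition ch_adj (V : finType) (m : nat) (Phi : 'I_m -> {set V}) : rel V :=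
  [rel u v | (u != v) && [exists i, (u \in Phi i) && (v \in Phi i)]].

Definition colorable (V : finType) (A : {set V}) (e : rel V) (k : nat) : Prop :=
  exists c : {x : V | x \in A} -> 'I_k,
    forall u v, e (val u) (val v) -> c u != c v.

Definition clique_hole_colorable (V : finType) (m : nat)
    (Phi : 'I_m -> {set V}) : Prop :=
  colorable (ch_vertices Phi) (ch_adj Phi) m.

(* Main.v *)
Require Import Defs.
From mathcomp Require Import all_boot.
From mathcomp Require Import zify.

(** Write [E i] for the intersection of cliques [i] and [i + 1]. As [4 <= m], no
vertex lies in three cliques, so clique [i + 1] meets the sets [E j] only in the
disjoint sets [E i] and [E (i + 1)]. In a colouring a colour therefore never
occurs in both [E i] and [E (i + 1)], hence occurs in at most [m %/ 2] of the
[E i]; summing over the [m] colours gives the bound.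
Conversely, give [E i] an arc of [#|E i|] consecutive colours modulo [m] that
starts at [x i]. The arcs of [E i] and [E (i + 1)] are disjoint when
[x (i + 1) - x i] lies between [#|E i|] and [m - #|E (i + 1)|], and going around
the cycle is consistent when these steps add up to a multiple of [m]. The bound
is what makes the total [m * (m %/ 2)] reachable. The vertices lying in a single
clique are then coloured greedily. *)

Lemma iter_ordS_val m n (i : 'I_m) : iter n (@ordS m) i = (i + n) %% m :> nat.
Proof.
elim: n => [|n IHn]; first by rewrite addn0 modn_small.
by rewrite iterS /= IHn addnS -addn1 modnDml addn1.
Qed.

Lemma iter_ordS_neq m n (i : 'I_m) : 0 < n < m -> iter n (@ordS m) i != i.
Proof.
case/andP=> n_gt0 n_ltm; apply/eqP=> /(congr1 val) /=; rewrite iter_ordS_val.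
rewrite -{2}(modn_small (ltn_ord i)) -{2}[val i]addn0 => /eqP.
by rewrite eqn_modDl mod0n modn_small // eqn0Ngt n_gt0.
Qed.

(** [B] and its image under [ordS] are disjoint and equally large, so they fit together in
    ['I_m]. *)
Lemma card_no_ordS_consecutive m (B : {set 'I_m}) :
  {in B, forall i, ordS i \notin B} -> #|B| <= m %/ 2.
Proof.
move=> Bfree.
have dis : [disjoint B & @ordS m @: B].
  rewrite disjoint_sym; apply/pred0P=> y /=; apply/negP => /andP[/imsetP[x xB ->]].
  by apply/negP; apply: Bfree.
have := max_card (B :|: @ordS m @: B).
rewrite cardsU (disjoint_setI0 dis) cards0 subn0 card_ord.
rewrite card_imset ?leq_divRL //; last exact: ordS_inj.
by rewrite muln2 -addnn.
Qed.

(** Discrete intermediate values: start from [l] and raise by one some coordinate still below [u],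
    until the sum is [N]. *)
Lemma sum_between (I : finType) (l u : I -> nat) N :
    (forall i, l i <= u i) -> \sum_i l i <= N <= \sum_i u i ->
  exists2 d : I -> nat, forall i, l i <= d i <= u i & \sum_i d i = N.
Proof.
move=> le_lu /andP[/subnKC <-]; elim: (N - _) => [|k IHk] le_u.
  by exists l => [i|]; rewrite ?leqnn ?addn0 ?le_lu.
have [|d d_lu sum_d] := IHk; first by apply: leq_trans le_u; lia.
have [i lt_i] : exists i, d i < u i.
  apply/existsP; apply: contraTT le_u => /existsPn ge_d.
  rewrite -ltnNge addnS ltnS -sum_d; apply: leq_sum => i _.
  by rewrite leqNgt ge_d.
exists (fun j => d j + (j == i)) => [j|].
  have := d_lu j; case: eqP => [->|_]; lia.
rewrite big_split /= sum_d addnS -addn1; congr (_ + _).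
by rewrite (bigD1 i) //= eqxx big1 ?addn0 // => j /negPf->.
Qed.

(** The greedy step inside one clique: the values that [f] leaves free are at least as many as the
    points of [A :\: D], which take them in enumeration order. *)
Lemma extend_injective {V T : finType} {A D : {set V}} {f : V -> T} :
    {in A :&: D &, injective f} -> #|A| <= #|T| ->
  exists2 g : V -> T, {in A &, injective g} & {in A :&: D, f =1 g}.
Proof.
move=> f_inj leAT; set R := ~: (f @: (A :&: D)).
have leR : #|A :\: D| <= #|R|.
  have := cardsC (f @: (A :&: D)); rewrite card_in_imset // -/R.
  have := cardsID D A; lia.
(* A free value [t0] is needed as the default of [nth]; if there is none, [A :\: D] is empty and [f]
   itself works. *)
have [R0|[t0 t0R]] := set_0Vmem R.
  have AD0 : A :\: D = set0 by apply/eqP; rewrite -cards_eq0 -leqn0 -(cards0 T) -R0.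
  have AID : A :&: D = A by rewrite -[RHS](setID A D) AD0 setU0.
  by exists f => //; rewrite -AID.
pose g v := if v \in D then f v else nth t0 (enum R) (index v (enum (A :\: D))).
have idx v : v \in A -> v \notin D -> index v (enum (A :\: D)) < size (enum R).
  move=> vA vD; rewrite -cardE; apply: leq_trans leR.
  by rewrite cardE index_mem mem_enum inE vD.
have gR v : v \in A -> v \notin D -> g v \in R.
  by move=> vA vD; rewrite /g (negPf vD) -mem_enum mem_nth ?idx.
have gD v : v \in A -> v \in D -> g v \notin R.
  by move=> vA vD; rewrite /g vD inE negbK imset_f // inE vA.
exists g => [u v uA vA|v]; last by rewrite inE /g => /andP[_ ->].
case: (boolP (u \in D)) (boolP (v \in D)) => [uD|uD] [vD|vD] eq_g.
- by move: eq_g; rewrite /g uD vD; apply: f_inj; rewrite inE ?uA ?vA.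
- by have := gD u uA uD; rewrite eq_g gR.
- by have := gD v vA vD; rewrite -eq_g gR.
move/eqP: eq_g; rewrite /g (negPf uD) (negPf vD).
rewrite nth_uniq ?idx ?enum_uniq // => /eqP.
by apply: index_inj; rewrite ?mem_enum ?inE ?uD ?vD.
Qed.

Lemma modn_neq_lt m x y : x < y < x + m -> x != y %[mod m].
Proof.
case/andP=> ltxy ltym; rewrite eq_sym eqn_mod_dvd ?(ltnW ltxy) //.
by apply/negP=> /dvdn_leq; lia.
Qed.

(** Only the wrap-around at the last index uses the hypothesis: there the left sum is empty and the
    right side is the full sum. *)
Lemma sum_lt_ordS m (d : 'I_m -> nat) (i : 'I_m) : \sum_j d j = 0 %[mod m] ->
  \sum_(j < m | j < ordS i) d j = \sum_(j < m | j < i) d j + d i %[mod m].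
Proof.
move=> d0.
have sumS : \sum_(j < m | j < i) d j + d i = \sum_(j < m | j < i.+1) d j.
  rewrite [RHS](bigD1 i) //= addnC; congr (_ + _); apply: eq_bigl => j.
  by rewrite ltnS [RHS]andbC -ltn_neqAle.
rewrite sumS /=; case: (ltngtP i.+1 m) (ltn_ord i) => // [lt_i|eq_i] _.
  by rewrite (modn_small lt_i).
rewrite {1}eq_i modnn big_pred0 // eq_i -d0; congr (_ %% _).
by apply: eq_bigl => j; rewrite ltn_ord.
Qed.

Lemma colorableP (m : nat) (V : finType) (Phi : 'I_m -> {set V}) : 0 < m ->
  clique_hole_colorable Phi <->
  exists c : V -> 'I_m, forall i, {in Phi i &, injective c}.
Proof.
move=> m_gt0; split=> [[c col_c]|[c inj_c]].
  exists (fun v => if insub v is Some x then c x else Ordinal m_gt0).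
  move=> i u v uPi vPi.
  have memV w : w \in Phi i -> w \in ch_vertices Phi.
    by move=> wPi; apply/bigcupP; exists i.
  rewrite (insubT (fun w => w \in ch_vertices Phi) (memV u uPi)).
  rewrite (insubT (fun w => w \in ch_vertices Phi) (memV v vPi)).
  move=> eq_c; apply/eqP; apply: contra_eqT eq_c => neq_uv; apply: col_c.
  by rewrite /ch_adj /= neq_uv; apply/existsP; exists i; rewrite uPi.
exists (fun x => c (val x)) => u v /andP[neq_uv /existsP[i /andP[uPi vPi]]].
by apply: contraNneq neq_uv => /(inj_c i _ _ uPi vPi)->.
Qed.

Section Overlaps.

Variables (m : nat) (V : finType) (Phi : 'I_m -> {set V}).
Hypotheses (hm : 4 <= m) (hPhi : clique_hole Phi).

Let E (i : 'I_m) := Phi i :&: Phi (ordS i).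

Lemma overlap_mem {v i j} : v \in E j -> v \in Phi i -> (i == j) || (i == ordS j).
Proof.
rewrite inE => /andP[vj vSj] vi.
have [//|neq_ij] := eqVneq i j; rewrite /=.
have meets k l : v \in Phi k -> v \in Phi l -> k != l ->
    (l == ordS k) || (l == ord_pred k).
  move=> vk vl neq_kl; rewrite -(ch_cycle hPhi neq_kl).
  by apply/set0Pn; exists v; rewrite inE vk.
(* The remaining case is [j = ordS i]. Clique [i] then also meets clique [i + 2], which would close
   a cycle of length 3 or 1; [4 <= m] excludes both. *)
have := meets j i vj vi; rewrite eq_sym => /(_ neq_ij) /orP[//|/eqP def_i].
have def_j : j = ordS i by rewrite def_i ord_predK.
have neq n : 0 < n < 4 -> iter n (@ordS m) i != i.
  by move=> lt_n; apply: iter_ordS_neq; lia.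
have := meets (ordS j) i vSj vi; rewrite def_j => /(_ (neq 2 isT)).
case/orP=> [/eqP/esym eq_i|/eqP eq_i].
  by have := neq 3 isT; rewrite /= eq_i eqxx.
by have := neq 1 isT; rewrite {2}eq_i ordSK /= eqxx.
Qed.

Lemma overlap_uniq {v i j} : v \in E i -> v \in E j -> i = j.
Proof.
move=> vEi vEj.
have [vi vj] : v \in Phi i /\ v \in Phi j.
  by move: vEi vEj; rewrite !inE => /andP[-> _] /andP[-> _].
case/orP: (overlap_mem vEj vi) => /eqP // def_i.
case/orP: (overlap_mem vEi vj) => /eqP // def_j.
have : iter 2 (@ordS m) i != i by apply: iter_ordS_neq; lia.
by rewrite /= -def_j -def_i eqxx.
Qed.

Lemma overlap_disjoint i : E i :&: E (ordS i) = set0.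
Proof.
apply/setP=> v; rewrite in_set0 in_setI; apply/negP => /andP[vEi vESi].
have : iter 1 (@ordS m) i != i by apply: iter_ordS_neq; lia.
by rewrite /= -(overlap_uniq vEi vESi) eqxx.
Qed.

Lemma card_overlapD i : #|E i| + #|E (ordS i)| <= m.
Proof.
rewrite -[X in X <= _]subn0 -(cards0 V) -(overlap_disjoint i) -cardsU.
apply: leq_trans (ch_card hPhi (ordS i)); apply: subset_leq_card.
by rewrite subUset subsetIr subsetIl.
Qed.

Lemma colorable_sum_overlap (c : V -> 'I_m) :
  (forall i, {in Phi i &, injective c}) -> \sum_i #|E i| <= m * (m %/ 2).
Proof.
move=> inj_c.
have cardE i : #|E i| = \sum_(k < m) (k \in c @: E i).
  rewrite -(@card_in_imset _ _ c) ?sum1_card.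
    by rewrite -sum1_card big_mkcond /=; apply: eq_bigr => k _; case: ifP.
  by move=> u v; rewrite !inE => /andP[ui _] /andP[vi _]; apply: inj_c ui vi.
(* Double counting of the pairs of an index [i] and a colour [k] occurring on [E i]. *)
rewrite (eq_bigr _ (fun i _ => cardE i)) exchange_big /=.
rewrite -[X in X * _]card_ord -sum_nat_const; apply: leq_sum => k _.
pose B := [set i | k \in c @: E i].
have -> : \sum_(i < m) (k \in c @: E i) = #|B|.
  rewrite -sum1_card [RHS]big_mkcond /=; apply: eq_bigr => i _.
  by rewrite inE; case: ifP.
apply: card_no_ordS_consecutive => i; rewrite !inE => /imsetP[u uE ->].
apply/imsetP=> -[v vE eq_c].
have eq_uv : u = v.
  apply: (inj_c (ordS i)) eq_c; first by move: uE; rewrite inE => /andP[].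
  by move: vE; rewrite inE => /andP[].
by have := in_set0 u; rewrite -(overlap_disjoint i) inE uE eq_uv vE.
Qed.

Lemma overlap_steps : \sum_i #|E i| <= m * (m %/ 2) ->
  exists2 d : 'I_m -> nat,
    forall i, #|E i| <= d i /\ d i + #|E (ordS i)| <= m
    & \sum_i d i = m * (m %/ 2).
Proof.
move=> le_sum; have le_m := card_overlapD.
pose u i := m - #|E (ordS i)|.
have sum_u : \sum_i u i + \sum_i #|E i| = m * m.
  rewrite [X in _ + X](reindex_inj (@ordS_inj m)) -big_split /=.
  rewrite -[X in _ = X * _]card_ord -sum_nat_const; apply: eq_bigr => i _.
  by rewrite /u subnK //; have := le_m i; lia.
have [||d d_lu sum_d] := @sum_between _ (fun i => #|E i|) u (m * (m %/ 2)).
- by move=> i; rewrite /u; have := le_m i; lia.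
(* For [N = m * (m %/ 2)], adding the overlap sum to [N] gives at most [2 * N <= m * m]. *)
- rewrite le_sum /= -(leq_add2r (\sum_i #|E i|)) sum_u.
  have : m * (m %/ 2) * 2 <= m * m by rewrite -mulnA leq_mul2l leq_divM orbT.
  by rewrite muln2 -addnn; apply: leq_trans; rewrite leq_add2l.
exists d => // i; have := d_lu i; have := le_m i; rewrite /u; lia.
Qed.

Lemma sum_overlap_colorable : \sum_i #|E i| <= m * (m %/ 2) ->
  exists c : V -> 'I_m, forall i, {in Phi i &, injective c}.
Proof.
move=> /overlap_steps[d d_lu sum_d].
have m_gt0 : 0 < m by lia.
pose x (i : 'I_m) := \sum_(j < m | j < i) d j.
have xS i : x (ordS i) = x i + d i %[mod m].
  by apply: sum_lt_ordS; rewrite sum_d modnMr mod0n.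
pose col i v := Ordinal (ltn_pmod (x i + index v (enum (E i))) m_gt0).
have idx i v : v \in E i -> index v (enum (E i)) < #|E i|.
  by move=> vE; rewrite cardE index_mem mem_enum.
have col_inj i : {in E i &, injective (col i)}.
  move=> u v uE vE /(congr1 val) /= /eqP; rewrite eqn_modDl.
  have le_m : #|E i| <= m by have := card_overlapD i; lia.
  rewrite !modn_small ?(leq_trans (idx _ _ _)) // => /eqP.
  by apply: index_inj; rewrite ?mem_enum.
have col_neq i u v : u \in E i -> v \in E (ordS i) -> col i u != col (ordS i) v.
  move=> /idx ltu /idx ltv; apply/eqP=> /(congr1 val) /= /eqP.
  rewrite -[X in _ == X]modnDml xS modnDml; apply/negP.
  (* The lower bound on [d i] puts the second position after the first, the upper bound keeps it
     less than [m] further. *)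
  by apply: modn_neq_lt; have := d_lu i; lia.
pose core := \bigcup_i E i.
pose c0 v := if [pick i | v \in E i] is Some i then col i v else Ordinal m_gt0.
have c0E i v : v \in E i -> c0 v = col i v.
  rewrite /c0 => vE; case: pickP => [j vEj|/(_ i)]; last by rewrite vE.
  by rewrite (overlap_uniq vE vEj).
have c0_inj i : {in Phi i :&: core &, injective c0}.
  move=> u v; rewrite !inE.
  case/andP=> ui /bigcupP[j _ uE] /andP[vi /bigcupP[k _ vE]].
  rewrite (c0E j u) // (c0E k v) //.
  (* Within clique [i], each of [u] and [v] lies in [E i] or in the preceding overlap: equal
     overlaps use [col_inj], different ones [col_neq]. *)
  case/orP: (overlap_mem uE ui) (overlap_mem vE vi) => /eqP->;
    case/orP => /eqP eqk.
  - by subst k; apply: col_inj.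
  - by subst j => /esym/eqP; rewrite (negPf (col_neq _ _ _ vE uE)).
  - by subst k => /eqP; rewrite (negPf (col_neq _ _ _ uE vE)).
  - by move/ordS_inj: eqk => eqk; subst k; apply: col_inj.
(* Finite functions and a boolean property let [xchoose] select one extension for every [i]. *)
have ext i : exists g : {ffun V -> 'I_m},
    [forall u in Phi i, forall v in Phi i, (g u == g v) ==> (u == v)]
    && [forall v in Phi i :&: core, c0 v == g v].
  have [|g g_inj g_c0] := extend_injective (c0_inj i).
    by rewrite card_ord; apply: ch_card hPhi i.
  exists (finfun g); apply/andP; split.
    apply/forall_inP=> u ui; apply/forall_inP=> v vi; apply/implyP.
    by rewrite !ffunE => /eqP/(g_inj u v ui vi)->.
  by apply/forall_inP=> v /g_c0; rewrite ffunE => ->.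
pose g i := xchoose (ext i).
have g_inj i : {in Phi i &, injective (g i)}.
  move=> u v ui vi /eqP eq_g; apply/eqP.
  case/andP: (xchooseP (ext i)) => /forall_inP/(_ u ui)/forall_inP/(_ v vi).
  by move/implyP/(_ eq_g).
have g_c0 i v : v \in Phi i -> v \in core -> g i v = c0 v.
  move=> vi vC; case/andP: (xchooseP (ext i)) => _ /forall_inP/(_ v).
  by rewrite inE vi vC => /(_ isT)/eqP.
pose c v := if [pick i | v \in Phi i] is Some i then g i v else Ordinal m_gt0.
(* The picked clique does not matter: a vertex of two cliques lies in [core], where every [g i]
   agrees with [c0]. *)
have cE i v : v \in Phi i -> c v = g i v.
  rewrite /c => vi; case: pickP => [j vj|/(_ i)]; last by rewrite vi.
  have [->//|neq_ij] := eqVneq i j.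
  suff vC : v \in core by rewrite !g_c0.
  have : Phi i :&: Phi j != set0 by apply/set0Pn; exists v; rewrite inE vi.
  rewrite (ch_cycle hPhi neq_ij) => /orP[]/eqP eq_j; apply/bigcupP.
    by exists i; rewrite // inE vi -eq_j vj.
  by exists j; rewrite // inE vj eq_j ord_predK vi.
by exists c => i u v ui vi; rewrite !(cE i) //; apply: g_inj.
Qed.

End Overlaps.

Theorem theorem2p1 (m : nat) (V : finType) (Phi : 'I_m -> {set V})
    (hm : 4 <= m) (hPhi : clique_hole Phi) :
  clique_hole_colorable Phi <->
  \sum_(i < m) #|Phi i :&: Phi (ordS i)| <= m * (m %/ 2).
Proof.
rewrite colorableP; last by apply: leq_trans hm.
split=> [[c inj_c]|]; first exact: colorable_sum_overlap hm hPhi c inj_c.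
exact: sum_overlap_colorable.
Qed.
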